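(* Let $p\ge 1$ be a rational number. For integers $n\ge 0$ and $j$ with $0\le j\le n$ let $$w_j(n):=n!\,p^n\,u^{(p)}_{0,n-j}(n),$$ and let $w_j(n):=0$ if $j<0$ or $j>n$. Then $w_0(0)=1$ and, for all $n\ge1$ and $0\le j\le n$, $$w_j(n)=(pn-1)\,w_j(n-1)+w_{j-1}(n-1).$$
   Context: For $0\le i,j\le n$ the numbers $u^{(p)}_{ij}(n)$ are defined by $$u^{(p)}_{ij}(n)=\sum_{k=i}^{n}\ \sum_{l=n-j}^{k}\frac{s(k,l)\,(-1)^{n-j-l}}{k!\,p^{l}}\binom{l}{n-j}\binom{n-i}{n-k},$$ where $s(k,l)=(-1)^{k-l}\,\sharp\{\sigma\in S_k:\sigma\text{ has }l\text{ cycles}\}$ is the signed Stirling number of the first kind (with $s(0,0)=1$); empty sums are $0$. (These are the entries of the matrix of right eigenvectors of the transition matrix of the $(\pm b,n,p)$-carries process; the parameters $p\geq 1$ for which such a process exists for some integer base $b\ge2$, i.e. for which $\frac{b-1}{p}$ or $\frac{b+1}{p}$ is a positive integer for some $b$, are the rationals $p\ge1$.) *)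

(* Defs.v *)
From HB Require Import structures.
From mathcomp Require Import all_boot all_order all_algebra all_fingroup.

Set Implicit Arguments.
Unset Strict Implicit.
Unset Printing Implicit Defensive.

Import Order.TTheory GRing.Theory Num.Theory.
Local Open Scope ring_scope.

(* [porbits sigma] counts fixed points as cycles, and is empty for the unique
   permutation of 'I_0, so that stirling1 0 0 = 1. *)
Definition stirling1 (k l : nat) : int :=
  (-1) ^+ (k - l) * #|[set sigma : 'S_k | #|porbits sigma| == l]|%:Z.

(* Meaningful for i, j <= n, where the nat subtractions are not truncated;
   the exponent of -1 is at most 0 and is computed in int. *)
Definition eigen_u (p : rat) (n i j : nat) : rat :=
  \sum_(i <= k < n.+1) \sum_(n - j <= l < k.+1)
    ((stirling1 k l)%:~R * (-1) ^ (n%:Z - j%:Z - l%:Z)) / (k`!%:R * p ^+ l)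
    * 'C(l, n - j)%:R * 'C(n - i, n - k)%:R.

Definition w (p : rat) (n : nat) (j : int) : rat :=
  match j with
  | Posz m => if (m <= n)%N then n`!%:R * p ^+ n * eigen_u p n 0 (n - m) else 0
  | Negz _ => 0
  end.

(* Main.v *)
Require Import Defs.
From HB Require Import structures.
From mathcomp Require Import all_boot all_order all_algebra all_fingroup.
From mathcomp Require Import ring.

Set Implicit Arguments.
Unset Strict Implicit.
Unset Printing Implicit Defensive.

Import Order.TTheory GRing.Theory Num.Theory.
Local Open Scope ring_scope.

(** Fix n and collect the numbers w_m(n) in the generating polynomial
    W_n(y) = \sum_m w_m(n) y^m. The statement is the coefficientwise form of
    W_{n+1} = (y - 1 + p (n + 1)) W_n, together with W_0 = 1.

    To see this, sum the double sum defining u over m first. By the binomial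
    theorem, \sum_m 'C(l, m) (-1)^(m - l) y^m / p^l = x^l with x = (y - 1) / p
    ([coef_scale_subX1]), so only \sum_l s(k, l) x^l is left inside; this is
    the falling factorial x (x - 1) ... (x - k + 1) ([sum_stirling1]).
    Therefore W_n = n! p^n V_n, where V_n = \sum_k 'C(n, k) binom(x, k) is a
    Chu-Vandermonde sum, equal to binom(x + n, n). The closed form itself is
    bypassed: the relation (n + 1) V_{n+1} = (x + n + 1) V_n
    ([vandermonde_sumS]) suffices, since p (x + n + 1) = y - 1 + p (n + 1).

    As the Stirling numbers are given by counting permutations, the falling
    factorial identity rests on the cycle-counting formula
    \sum_s x^(cycles of s) = x (x + 1) ... (x + n - 1)
    ([sum_expr_card_porbits]). It is proved by writing each permutation of
    n + 1 points uniquely as a transposition (0 y), possibly trivial, times a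
    permutation fixing 0: the nontrivial transpositions merge the cycle {0}
    into another one, the trivial one leaves it as an additional cycle. *)

(** * Counting permutations by number of cycles *)

Lemma card_porbits_lift0 n (s : 'S_n) :
  #|porbits (lift_perm ord0 ord0 s)| = #|porbits s|.+1.
Proof.
set t := lift_perm ord0 ord0 s.
have tX i : (t ^+ i = lift_perm ord0 ord0 (s ^+ i))%g.
  elim: i => [|i IH]; first by rewrite !expg0 lift_perm1.
  by rewrite !expgS IH lift_permM.
have orb0 : porbit t ord0 = [set ord0].
  apply/setP=> y; rewrite inE; apply/porbitP/eqP => [[i ->]|->].
    by rewrite tX lift_perm_id.
  by exists 0%N; rewrite expg0 perm1.
have orbS x : porbit t (lift ord0 x) = lift ord0 @: porbit s x.
  apply/setP=> y; apply/porbitP/imsetP => [[i ->]|[z /porbitP[i ->] ->]].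
    by exists ((s ^+ i)%g x); rewrite ?mem_porbit // tX lift_perm_lift.
  by exists i; rewrite tX lift_perm_lift.
have -> : porbits t =
    [set ord0] |: [set lift ord0 @: (A : {set 'I_n}) | A in porbits s].
  apply/setP=> A; rewrite !inE; apply/imsetP/orP => [[x _ ->]|].
    case: (unliftP ord0 x) => [x' ->|->]; last by rewrite orb0 eqxx; left.
    by right; rewrite orbS imset_f // imset_f.
  case=> [/eqP->|/imsetP[B /imsetP[x _ ->] ->]].
    by exists ord0.
  by exists (lift ord0 x).
rewrite cardsU1 card_imset; last exact/imset_inj/lift_inj.
case: imsetP => // -[B _ /setP/(_ ord0)].
by rewrite set11 => /esym/imsetP[x _ /eqP]; rewrite (negPf (neq_lift _ _)).
Qed.

(** Multiplying by (0 y) with y <> 0 merges the cycle of y with the fixed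
    point 0, which undoes the additional cycle of the lifted permutation. *)
Lemma card_porbits_tperm_lift0 n (y : 'I_n.+1) (s : 'S_n) :
  #|porbits (tperm ord0 y * lift_perm ord0 ord0 s)%g|
    = (#|porbits s| + (y == ord0))%N.
Proof.
set t := lift_perm _ _ s.
have := porbits_mul_tperm t ord0 y; rewrite card_porbits_lift0 -/t eq_sym.
have -> : (ord0 \notin porbit t y) = (y != ord0).
  rewrite porbit_sym; congr (~~ _); apply/porbitP/eqP => [[i ->]|->].
    by elim: i => [|i IH]; rewrite ?expg0 ?perm1 // expgSr permM IH lift_perm_id.
  by exists 0%N; rewrite expg0 perm1.
by case: eqP => _ /=; rewrite ?addn0 ?addn1 ?addn2 // => -[].
Qed.

(** Every permutation of n + 1 points has a unique factorization
    (0 y) * s with s fixing 0: y must be the preimage of 0, and surjectivity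
    comes from (n + 1)! = (n + 1) * n!. *)
Lemma sum_tperm_lift0 (R : nmodType) n (F : 'S_n.+1 -> R) :
  \sum_(s : 'S_n.+1) F s =
  \sum_(s : 'S_n) \sum_(y < n.+1) F (tperm ord0 y * lift_perm ord0 ord0 s)%g.
Proof.
pose f (u : 'S_n * 'I_n.+1) := (tperm ord0 u.2 * lift_perm ord0 ord0 u.1)%g.
rewrite pair_big /= (reindex f) //=; apply/onW_bij/inj_card_bij; last first.
  by rewrite card_prod !card_Sn card_ord factS mulnC.
move=> [s y] [s' y'] eqf; rewrite /f /= in eqf.
have yE : y = y'.
  have fy (z : 'I_n.+1) (r : 'S_n) :
      (tperm ord0 z * lift_perm ord0 ord0 r)%g z = ord0.
    by rewrite permM tpermR lift_perm_id.
  by apply: (@perm_inj _ (f (s, y))); rewrite [in RHS]/f /= eqf !fy.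
subst y'; congr (_, _); apply/permP=> x; move/mulgI/permP/(_ (lift ord0 x)): eqf.
by rewrite !lift_perm_lift => /lift_inj.
Qed.

(** Among the n + 1 choices of y, one contributes an additional factor x and
    the n others leave the number of cycles unchanged, whence the factor
    x + n at each step. *)
Lemma sum_expr_card_porbits (R : comNzRingType) (x : R) n :
  \sum_(s : 'S_n) x ^+ #|porbits s| = \prod_(i < n) (x + i%:R).
Proof.
elim: n => [|n IH].
  rewrite big_ord0 (eq_bigr (fun=> 1)) => [|s _].
    by rewrite sumr_const card_Sn.
  have -> : porbits s = set0; last by rewrite cards0.
  by apply/setP=> A; rewrite inE; apply/imsetP=> -[[]].
rewrite sum_tperm_lift0 big_ord_recr /= -IH mulr_suml.
apply: eq_bigr => s _; rewrite big_ord_recl /= card_porbits_tperm_lift0 addn1.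
rewrite (eq_bigr (fun=> x ^+ #|porbits s|)) => [|i _].
  by rewrite sumr_const card_ord exprSr mulrDr mulr_natr.
by rewrite card_porbits_tperm_lift0 addn0.
Qed.

(** * Stirling numbers and falling factorials *)

Lemma card_porbits_le k (s : 'S_k) : (#|porbits s| <= k)%N.
Proof. by rewrite -[leqRHS]card_ord leq_imset_card. Qed.

(** This is the cycle-counting formula at - x: the sign (-1)^k pulled out of
    the product combines with (-1)^l to the sign (-1)^(k - l) of s(k, l). *)
Lemma sum_stirling1 (R : comNzRingType) (x : R) k :
  \sum_(l < k.+1) (stirling1 k l)%:~R * x ^+ l = \prod_(i < k) (x - i%:R).
Proof.
have -> : \prod_(i < k) (x - i%:R) = (-1) ^+ k * \prod_(i < k) (- x + i%:R).
  rewrite -[in X in (-1) ^+ X](card_ord k) -prodr_const -big_split /=.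
  by apply: eq_bigr => i _; ring.
rewrite -sum_expr_card_porbits mulr_sumr.
pose c (s : 'S_k) : 'I_k.+1 := Ordinal (card_porbits_le s : _ < k.+1)%N.
rewrite (partition_big c predT) //=; apply: eq_bigr => l _.
rewrite (eq_bigr (fun=> (-1) ^+ (k - l) * x ^+ l)) => [|s /eqP<- /=]; last first.
  rewrite (exprNn x) mulrA -exprD; congr (_ * _).
  have -> : (k + #|porbits s| = k - #|porbits s| + #|porbits s|.*2)%N.
    by rewrite -addnn addnA subnK // card_porbits_le.
  by rewrite exprD -muln2 exprM sqrr_sign mulr1.
rewrite sumr_const /stirling1 rmorphM rmorphXn /= rmorphN1.
rewrite -[RHS]mulr_natr [LHS]mulrAC -pmulrn; congr (_ * _ * _).
congr (_%:R); by apply: eq_card => s; rewrite inE.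
Qed.

(** * A Chu-Vandermonde recurrence *)

(** The binomial coefficient binom(x, k) with an arbitrary upper argument. *)
Definition gbinom (A : comAlgType rat) (x : A) k : A :=
  k`!%:R^-1 *: \prod_(i < k) (x - i%:R).

Lemma gbinomS (A : comAlgType rat) (x : A) k : 
  (x - k%:R) * gbinom x k = k.+1%:R * gbinom x k.+1.
Proof.
rewrite /gbinom big_ord_recr /= factS natrM invfM -scalerAr [RHS]mulr_natl.
by rewrite -[RHS]scaler_nat [RHS]scalerA mulrA mulfV ?pnatr_eq0 // mul1r mulrC.
Qed.

Definition vandermonde_sum (A : comAlgType rat) (x : A) n : A :=
  \sum_(k < n.+1) 'C(n, k)%:R * gbinom x k.

(** Splitting x + n + 1 as (x - k) + (n + 1 + k) in the k-th summand and
    absorbing x - k into binom(x, k) turns the right-hand side into a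
    combination of the binom(x, k), whose coefficients are compared using
    Pascal's rule and (k + 1) 'C(n, k + 1) = (n - k) 'C(n, k). *)
Lemma vandermonde_sumS (A : comAlgType rat) (x : A) n :
  n.+1%:R * vandermonde_sum x n.+1 = (x + n.+1%:R) * vandermonde_sum x n.
Proof.
have step k : (x + n.+1%:R) * ('C(n, k)%:R * gbinom x k) =
    ('C(n, k) * (n.+1 + k))%:R * gbinom x k
      + ('C(n, k) * k.+1)%:R * gbinom x k.+1.
  by rewrite !natrM -[X in _ = _ + X]mulrA -gbinomS !natrD; ring.
rewrite /vandermonde_sum [RHS]mulr_sumr (eq_bigr _ (fun (k : 'I__) _ => step k)).
rewrite big_split /=.
have -> : \sum_(k < n.+1) ('C(n, k) * (n.+1 + k))%:R * gbinom x k =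
    \sum_(k < n.+2) ('C(n, k) * (n.+1 + k))%:R * gbinom x k.
  by rewrite [RHS]big_ord_recr /= bin_small // mul0n mul0r addr0.
rewrite [in RHS]big_ord_recl [in LHS]big_ord_recl mulrDr -addrA; congr (_ + _).
  by rewrite !bin0 mul1r addn0 mul1n.
rewrite mulr_sumr -big_split /=; apply: eq_bigr => k _.
rewrite /bump /= ?add1n mulrA -natrM -mulrDl -natrD; congr (_%:R * _).
have lekn : (k <= n)%N by rewrite -ltnS.
rewrite binS !mulnDr [('C(n, k.+1) * k.+1)%N]mulnC mul_bin_left.
rewrite -addnA ![(n.+1 * _)%N]mulnC; congr (_ + _)%N.
by rewrite [((n - k) * _)%N]mulnC -mulnDr addnS subnK.
Qed.

(** * The generating polynomial *)

Lemma coef_scale_subX1 (p : rat) l m :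
  ((p^-1 *: ('X - 1)) ^+ l)`_m = (-1) ^ (m%:Z - l%:Z) / p ^+ l * 'C(l, m)%:R.
Proof.
rewrite exprZn coefZ addrC exprDn coef_sum exprVn.
have coefE i : ((-1) ^+ (l - i) * 'X^i *+ 'C(l, i) : {poly rat})`_m =
    if m == i then (-1) ^+ (l - i) *+ 'C(l, i) else 0.
  rewrite coefMn -polyCN -polyC_exp coefCM coefXn.
  by case: eqP; rewrite ?mulr1 // mulr0 mul0rn.
rewrite (eq_bigr _ (fun (i : 'I__) _ => coefE i)).
case: (leqP m l) => [leml|ltlm]; last first.
  rewrite bin_small // mulr0 big1 ?mulr0 // => i _.
  by rewrite gtn_eqF // (leq_trans _ ltlm).
rewrite (bigD1 (Ordinal (leml : m < l.+1)%N)) //= eqxx big1 => [|i neim].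
  rewrite addr0 -[m%:Z - l%:Z]opprB subzn // -invr_expz -exprnP.
  by rewrite -[in RHS]signr_odd invr_sign signr_odd -mulr_natr; ring.
by rewrite ifN // eq_sym.
Qed.

Lemma coef_vandermonde_sum (p : rat) n m :
  (vandermonde_sum (p^-1 *: ('X - 1)) n)`_m =
  \sum_(k < n.+1) \sum_(l < k.+1)
    ((stirling1 k l)%:~R * (-1) ^ (m%:Z - l%:Z)) / (k`!%:R * p ^+ l)
    * 'C(l, m)%:R * 'C(n, k)%:R.
Proof.
rewrite coef_sum; apply: eq_bigr => k _.
rewrite mulr_natl coefMn /gbinom -sum_stirling1 coefZ coef_sum -[LHS]mulr_natr.
rewrite mulr_sumr mulr_suml; apply: eq_bigr => l _.
rewrite -(rmorph_int polyC) coefCM coef_scale_subX1 invfM.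
by congr (_ * _); ring.
Qed.

Definition wpoly (p : rat) n : {poly rat} :=
  (n`!%:R * p ^+ n) *: vandermonde_sum (p^-1 *: ('X - 1)) n.

(** The convention that w vanishes above n agrees with the coefficients, since
    'C(l, m) = 0 for l <= k <= n < m; the same vanishing removes the lower
    bound m on l in the definition of u. *)
Lemma coef_wpoly p n m : w p n m%:Z = (wpoly p n)`_m.
Proof.
rewrite /w coefZ coef_vandermonde_sum; case: leqP => [lemn|ltnm]; last first.
  rewrite big1 ?mulr0 // => k _; rewrite big1 // => l _.
  rewrite bin_small ?mulr0 ?mul0r //.
  by rewrite (leq_ltn_trans _ ltnm) // -ltnS (leq_trans (ltn_ord l)).
congr (_ * _); rewrite /eigen_u subKn // big_mkord; apply: eq_bigr => k _.
rewrite -subzn // opprB addrCA subrr addr0 subn0 bin_sub -1?ltnS //.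
rewrite (big_nat_widenl _ 0%N) //= big_mkord big_mkcond; apply: eq_bigr => l _.
by case: leqP => // ltlm; rewrite bin_small // mulr0 mul0r.
Qed.

Lemma wpolyS p n : p != 0 ->
  wpoly p n.+1 = ('X + (p * n.+1%:R - 1)%:P) * wpoly p n.
Proof.
move=> p0; rewrite /wpoly; set x := p^-1 *: _.
have -> : 'X + (p * n.+1%:R - 1)%:P = p *: (x + n.+1%:R) :> {poly rat}.
  rewrite scalerDr scalerA mulfV // scale1r -(rmorph_nat polyC) /=.
  by rewrite -mul_polyC -polyCM polyCB; ring.
rewrite -scalerAl -scalerAr -vandermonde_sumS.
rewrite [_ * vandermonde_sum x _]mulr_natl.
rewrite -[_ *+ n.+1]scaler_nat !scalerA factS natrM exprS.
by congr (_ *: _); ring.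
Qed.

Theorem theorem1p5 (p : rat) (hp : 1 <= p) :
  w p 0 0 = 1 /\
  forall (n : nat) (j : int), (1 <= n)%N -> 0 <= j <= n%:Z ->
    w p n j = (p * n%:R - 1) * w p n.-1 j + w p n.-1 (j - 1).
Proof.
have p0 : p != 0 by rewrite gt_eqF // (lt_le_trans ltr01).
split=> [|[//|n] [m|//] _ _].
  rewrite coef_wpoly /wpoly /vandermonde_sum /gbinom big_ord1 big_ord0 bin0.
  by rewrite /= fact0 expr0 invr1 scale1r !mulr1 scale1r coef1.
rewrite succnK !coef_wpoly wpolyS // mulrDl coefD coefXM coefCM addrC; congr (_ + _).
by case: m => [|m] //; rewrite intS addrAC subrr add0r coef_wpoly.
Qed.
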